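(* Let $G$ be a finite simple graph on $[n]$ and let $K$ be a field with $\operatorname{char}(K)\neq 2$. Then $L_G$ is a radical ideal of $K[x_1,\ldots,x_n,y_1,\ldots,y_n]$. In particular, if $K$ is algebraically closed, then $L_{\overline{G}}$ contains all polynomials in $K[x_1,\ldots,x_n,y_1,\ldots,y_n]$ vanishing on $\mathrm{OR}_2^{K}(G)$.
   Context: For a finite simple graph $H$ on $[n]=\{1,\ldots,n\}$ with edge set $E(H)$ and a field $K$, $L_H=(x_ix_j+y_iy_j : \{i,j\}\in E(H))\subset K[x_1,\ldots,x_n,y_1,\ldots,y_n]$. The graph $\overline{G}$ is the complementary graph of $G$ on $[n]$ (its edges are the 2-subsets of $[n]$ that are not edges of $G$). $\mathrm{OR}_2^K(G)\subseteq K^{n\times 2}$ is the vanishing set of $L_{\overline{G}}$, where the $i$-th row of a matrix gives the values of $(x_i,y_i)$; equivalently, it is the set of maps $\varphi:[n]\to K^2$ such that $\varphi(i)$ and $\varphi(j)$ are orthogonal for the standard scalar product whenever $\{i,j\}\in E(\overline{G})$. *)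

(* Defs.v *)
From HB Require Import structures.
From mathcomp Require Import all_boot all_algebra.
From mathcomp Require Import mpoly.

Set Implicit Arguments.
Unset Strict Implicit.
Unset Printing Implicit Defensive.

Import GRing.Theory.
Local Open Scope ring_scope.

(* Ideals are Prop-valued predicates: the boolean ideal structures of
   ring_quotient would require a decision procedure for membership and
   properness. *)
Definition is_ideal (R : comNzRingType) (I : R -> Prop) : Prop :=
  [/\ I 0, forall p q, I p -> I q -> I (p + q) & forall a p, I p -> I (a * p)].

Definition ideal_span (R : comNzRingType) (T : finType) (P : pred T)
    (F : T -> R) : R -> Prop :=
  fun p => exists c : T -> R, p = \sum_(t | P t) c t * F t.

Definition radical (R : comNzRingType) (I : R -> Prop) : R -> Prop :=
  fun p => exists m : nat, I (p ^+ m).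

Definition is_radical_ideal (R : comNzRingType) (I : R -> Prop) : Prop :=
  is_ideal I /\ (forall p, radical I p <-> I p).

(* A finite simple graph on [n] is a symmetric irreflexive relation on 'I_n;
   vertices are shifted to 0, ..., n - 1. *)
Definition is_simple_graph (n : nat) (G : rel 'I_n) : Prop :=
  ssrbool.symmetric G /\ irreflexive G.

Definition compl_graph (n : nat) (G : rel 'I_n) : rel 'I_n :=
  fun i j => (i != j) && ~~ G i j.

(* K[x_1, ..., x_n, y_1, ..., y_n] is {mpoly K[n + n]}, the x's first. *)
Definition xvar (K : fieldType) (n : nat) (i : 'I_n) : {mpoly K[n + n]} :=
  'X_(lshift n i).

Definition yvar (K : fieldType) (n : nat) (i : 'I_n) : {mpoly K[n + n]} :=
  'X_(rshift n i).

(* Each edge {i, j} occurs as both (i, j) and (j, i), with the same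
   generator. *)
Definition L_ideal (K : fieldType) (n : nat) (H : rel 'I_n) :
    {mpoly K[n + n]} -> Prop :=
  ideal_span (fun e : 'I_n * 'I_n => H e.1 e.2)
    (fun e => xvar K e.1 * xvar K e.2 + yvar K e.1 * yvar K e.2).

(* Row i of A gives the values of (x_i, y_i). *)
Definition eval_mx (K : fieldType) (n : nat) (p : {mpoly K[n + n]})
    (A : 'M[K]_(n, 2)) : K :=
  p.@[fun k => match split k with inl i => A i 0 | inr i => A i 1 end].

Definition vanishing_set (K : fieldType) (n : nat)
    (I : {mpoly K[n + n]} -> Prop) : 'M[K]_(n, 2) -> Prop :=
  fun A => forall p, I p -> eval_mx p A = 0.

Definition OR2 (K : fieldType) (n : nat) (G : rel 'I_n) :
    'M[K]_(n, 2) -> Prop :=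
  vanishing_set (@L_ideal K n (compl_graph G)).

(* Main.v *)
From HB Require Import structures.
From Stdlib Require Import Classical.
Require Import Defs.
From mathcomp Require Import all_boot all_algebra all_field ring zify.
From mathcomp Require Import mpoly.

Set Implicit Arguments.
Unset Strict Implicit.
Unset Printing Implicit Defensive.

Import GRing.Theory.
Local Open Scope ring_scope.

(** Suppose first that K contains a square root iota of -1.  In the coordinates
    u = x + iota y, v = x - iota y the generators of L_G become, up to the factor
    2, the permanents u_i v_j + u_j v_i of the edges ij, and these are binomials:
    modulo the ideal, monomials are only identified up to sign or killed.

    Read a monomial as a configuration of chips (letters u) and holes (letters
    v) on its support. An edge relation moves a chip to a neighbour at the cost
    of a sign, and [path_exchange] does the same along a simple path inside the
    support. Hence two monomials with equal degree at every vertex and equally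
    many chips in every component of the support are equal up to sign. If in a
    component with both chips and holes two simple paths between the same
    vertices have different parities, the signs contradict each other and the
    monomial is in the ideal ([odd_class_mem]); otherwise parities of paths
    give a proper 2-colouring ([odd_pair]), and the sign is read off from the
    colours ([weight_class]). In that case the class of the monomial survives,
    and it is seen by a family of points of the vanishing set: u_i = alpha_i
    t_i p_c, v_i = beta_i t_i, where t_i is a parameter for each vertex, p_c
    one for each component c, and the signs of beta follow the colouring. The
    image of a monomial under this parametrization determines its class.
    Therefore a polynomial killed by all parametrizations that kill the ideal
    lies in the ideal ([mem_of_params]).

    Both assertions follow.  The parametrizations take values in a polynomial
    ring, which is reduced, so a polynomial with a power in the ideal is killed
    by all of them.  Over an algebraically closed field, a polynomial vanishing
    on the vanishing set vanishes at all values of the parametrizations, and is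
    killed by them because a polynomial that vanishes at all points is 0
    ([closed_mpoly_eq0]).

    If K has no square root of -1, adjoin one.  Membership in an ideal generated
    by polynomials over K does not change under field extension: apply a
    K-linear form that maps 1 to 1 to the coefficients ([ideal_span_descent]). *)

(** * Ideals spanned by finite families *)
Section Ideals.
Variables (R : comNzRingType).

Section IdealTheory.
Variables (I : R -> Prop) (idI : is_ideal I).

Lemma ideal0 : I 0. Proof. by case: idI. Qed.
Lemma idealD p q : I p -> I q -> I (p + q). Proof. by case: idI => _ + _; apply. Qed.
Lemma idealMl a p : I p -> I (a * p). Proof. by case: idI => _ _; apply. Qed.
Lemma idealN p : I p -> I (- p). Proof. by rewrite -mulN1r; apply: idealMl. Qed.
Lemma idealB p q : I p -> I q -> I (p - q).
Proof. by move=> Ip Iq; apply: idealD => //; apply: idealN. Qed.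

Lemma ideal_sum (T : Type) (s : seq T) (P : pred T) (F : T -> R) :
  (forall t, P t -> I (F t)) -> I (\sum_(t <- s | P t) F t).
Proof. by move=> IF; apply: big_ind => //; [apply: ideal0|apply: idealD]. Qed.
End IdealTheory.

Section Span.
Variables (T : finType) (P : pred T) (F : T -> R).

Lemma ideal_span_is_ideal : is_ideal (ideal_span P F).
Proof.
split.
- by exists (fun=> 0); rewrite big1 // => t _; rewrite mul0r.
- move=> _ _ [c ->] [d ->]; exists (fun t => c t + d t).
  by rewrite -big_split; apply: eq_bigr => t _; rewrite mulrDl.
- move=> a _ [c ->]; exists (fun t => a * c t).
  by rewrite mulr_sumr; apply: eq_bigr => t _; rewrite mulrA.
Qed.

Lemma ideal_span_gen t : P t -> ideal_span P F (F t).
Proof.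
move=> Pt; exists (fun s => (s == t)%:R).
rewrite (bigD1 t) //= eqxx mul1r big1 ?addr0 // => s /andP[_ /negPf ->].
by rewrite mul0r.
Qed.

End Span.
End Ideals.

Lemma ideal_span_morph (R S : comNzRingType) (f : {rmorphism R -> S})
    (T : finType) (P : pred T) (F : T -> R) (J : S -> Prop) :
  is_ideal J -> (forall t, P t -> J (f (F t))) ->
  forall p, ideal_span P F p -> J (f p).
Proof.
move=> idJ JF _ [c ->]; rewrite rmorph_sum; apply: ideal_sum => // t Pt.
by rewrite rmorphM; apply: idealMl => //; apply: JF.
Qed.

Lemma is_ideal_zero (R : comNzRingType) : is_ideal (fun p : R => p = 0).
Proof. by split=> // [p q -> ->|a p ->]; rewrite ?addr0 ?mulr0. Qed.

(** * Parities of simple paths *)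
Section Parity.
Variables (T : finType) (e : rel T).
Hypotheses (sym_e : ssrbool.symmetric e) (irr_e : irreflexive e).

Definition simple_path (i j : T) (w : seq T) : bool :=
  [&& path e i w, uniq (i :: w) & last i w == j].

Lemma simple_pathP i j : connect e i j -> {w | simple_path i j w}.
Proof.
move=> cij; have : exists w, simple_path i j w.
  case/connectP: cij => w pw ->; case/shortenP: pw => w' pw' uw' _.
  by exists w'; apply/and3P; split.
by move/sigW.
Qed.

Lemma connect_e_sym : connect_sym e.
Proof. exact: sym_connect_sym. Qed.

(** When no two simple paths with the same ends have different parities, the
    parity of one chosen path from the root of the component is a proper
    2-colouring.  It is defined in all cases; [odd_pair] exploits its
    failures. *)
Definition colour (x : T) : bool :=
  odd (size (sval (simple_pathP
    (etrans (connect_e_sym (fingraph.root e x) x) (connect_root e x))))).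

(** Let P and Q be the chosen paths from the root to k and l.  If l is not on
    P, then P extended by the edge kl has the other parity than Q.  If l cuts P
    into P1 and P2, then either P1 and Q differ in parity, or P2 is an even
    path from l to k and competes with the edge itself. *)
Lemma odd_pair k l : e k l -> colour k = colour l ->
  exists i j p q, [/\ connect e i k, i != j, simple_path i j p, simple_path i j q
                    & odd (size p) != odd (size q)].
Proof.
rewrite /colour; case: simple_pathP => P /= sP; case: simple_pathP => Q /= sQ.
move=> ekl; have rkl : fingraph.root e l = fingraph.root e k.
  by apply/esym/(fingraph.rootP connect_e_sym)/connect1.
move: sP sQ; rewrite rkl; set r := fingraph.root e k.
move=> /and3P[pP uP /eqP lP] /and3P[pQ uQ /eqP lQ] par.
have crk : connect e r k by rewrite connect_e_sym connect_root.
have [lP'|lP'] := boolP (l \in r :: P); last first.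
  exists r, l, (rcons P l), Q; split => //.
  - by apply: contraNneq lP' => ->; rewrite mem_head.
  - apply/and3P; split; rewrite ?last_rcons ?rcons_path ?pP ?lP //.
    by rewrite -rcons_cons rcons_uniq lP' uP.
  - by apply/and3P; split => //; apply/eqP.
  - by rewrite size_rcons /= par; case: odd.
have lk : l != k by apply: contraTneq ekl => ->; rewrite irr_e.
case/splitPl: lP' pP uP lP par => P1 P2 lP1.
rewrite cat_path last_cat -cat_cons cat_uniq lP1 size_cat oddD.
move=> /andP[pP1 pP2] /and3P[uP1 nP uP2] lP2 par.
have [par1|par1] := eqVneq (odd (size P1)) (odd (size Q)).
  exists l, k, P2, [:: k]; split => //.
  - by rewrite connect_e_sym; apply: connect1.
  - apply/and3P; split; rewrite //= ?lP2 ?uP2 ?andbT //.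
    apply: contraNN nP => lP2'; apply/hasP; exists l => //.
    by rewrite -lP1 /= mem_last.
  - by rewrite /simple_path /= inE sym_e ekl eqxx lk.
  - by move: par; rewrite -par1 /=; case: odd; case: odd.
exists r, l, P1, Q; split => //.
- apply: contraNneq par1 => rl.
  have nil w : uniq (r :: w) -> last r w = l -> w = [::].
    by case: w => //= x w /andP[rw _] lw; rewrite rl -lw mem_last in rw.
  by rewrite (nil P1) // (nil Q).
- by apply/and3P; split => //; apply/eqP.
- by apply/and3P; split => //; apply/eqP.
Qed.

Lemma colour_path (eps : T -> bool) i w : path e i w ->
  (forall k l, connect e i k -> e k l -> eps k != eps l) ->
  odd (size w) = eps i (+) eps (last i w).
Proof.
elim: w i => [|k w IH] i /=; first by rewrite addbb.
move=> /andP[eik pw] alt; rewrite (IH k) // => [|x y ckx].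
  by have := alt _ _ (connect0 _ _) eik; case: (eps i); case: (eps k); case: (eps _).
by apply: alt; apply: connect_trans ckx; apply: connect1.
Qed.

End Parity.

(** * The permanental ideal and the exchange of two variables along a path *)
(** The variables of [xvar] and [yvar] are called u and v when the ring carries
    the permanental ideal; [L i] and [R i] are the indices of u_i and v_i. *)
Section Permanental.
Variables (K : fieldType) (n : nat) (G : rel 'I_n).

Local Notation U i := (xvar K (i : 'I_n)).
Local Notation V i := (yvar K (i : 'I_n)).
Local Notation L i := (lshift n i).
Local Notation R i := (rshift n i).

Definition perm_ideal : {mpoly K[n + n]} -> Prop :=
  ideal_span (fun e : 'I_n * 'I_n => G e.1 e.2)
    (fun e => U e.1 * V e.2 + U e.2 * V e.1).

Lemma perm_idealP : is_ideal perm_ideal.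
Proof. exact: ideal_span_is_ideal. Qed.

Lemma perm_edge i j : G i j -> perm_ideal (U i * V j + U j * V i).
Proof. by move=> Gij; apply: (@ideal_span_gen _ _ _ _ (i, j)). Qed.

Lemma mnm_split (m : 'X_{1..n + n}) i : (0 < m i)%N ->
  {m' | m = (U_(i) + m')%MM}.
Proof.
rewrite lt0n => mi; exists (m - U_(i))%MM.
by rewrite addmC submK // lep1mP.
Qed.

Definition mtot (m : 'X_{1..n + n}) (i : 'I_n) := (m (L i) + m (R i))%N.

Lemma lrE (i j : 'I_n) : (L i == R j = false) * (R i == L j = false)
  * ((L i == L j) = (i == j)) * ((R i == R j) = (i == j)).
Proof. by rewrite eq_lrshift eq_rlshift eq_lshift eq_rshift. Qed.

(** The relation u_i v_j = - u_j v_i of an edge says that, up to sign, the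
    letters u and v of two neighbours may be interchanged. For vertices joined
    by a longer path the interchange is made step by step, and each
    intermediate vertex has to lend one letter u or v: hence the hypothesis on
    [mtot]. The path has to be simple because a factor of the monomial may be
    borrowed only once. *)
Lemma path_exchange i w m : path G i w -> uniq (i :: w) ->
  (forall k, k \in w -> k != last i w -> 0 < mtot m k)%N ->
  perm_ideal ('X_[m] * (U i * V (last i w)
                        - (-1) ^+ size w * (U (last i w) * V i))).
Proof.
elim: w i m => [|k w IH] i m.
  by rewrite mul1r subrr mulr0 => _ _ _; apply: ideal0 perm_idealP.
set j := last _ _; rewrite [path _ _ _]/= cons_uniq => /andP[Gik pw] /andP[iw uw] mw.
case: w => [|l w] in IH j pw iw uw mw *.
  rewrite /= expr1 mulN1r opprK; apply: idealMl perm_idealP _ _ _.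
  exact: perm_edge.
have lastj : j = last k (l :: w) by [].
have kj : k != j.
  rewrite lastj /=; apply: contraTneq uw => ->.
  by rewrite /= mem_last.
have [z [m' [Ez zk Em']]] : exists z m', [/\ m = (U_(z) + m')%MM, z = L k \/ z = R k
    & forall x, x != k -> mtot m' x = mtot m x].
  have := mw k (mem_head _ _) kj; rewrite addn_gt0 => /orP[]/mnm_split[m' ->].
    exists (L k), m'; split; [by []|by left|move=> x xk].
    by rewrite /mtot !mnmDE !mnm1E !lrE eq_sym (negPf xk).
  exists (R k), m'; split; [by []|by right|move=> x xk].
  by rewrite /mtot !mnmDE !mnm1E !lrE [k == x]eq_sym (negPf xk).
have {}IH : perm_ideal ('X_[m'] * (U k * V j - (-1) ^+ (size w).+1 * (U j * V k))).
  apply: IH => // x xw xj; rewrite Em'; last first.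
    by apply: contraTneq uw => <- /=; move: xw => /= ->.
  by apply: mw; rewrite // inE xw orbT.
have Ig := perm_edge Gik.
rewrite Ez mpolyXD [size _]/= exprS mulN1r.
set s := (-1) ^+ _ in IH *.
case: zk => ->.
(* If k lends u, exchange k with j before i with k; if v, the other way round. *)
- have -> : 'X_(L k) * 'X_[m'] * (U i * V j - - s * (U j * V i))
    = U i * ('X_[m'] * (U k * V j - s * (U j * V k)))
      + 'X_[m'] * s * U j * (U i * V k + U k * V i).
    rewrite /xvar; ring.
  by apply: idealD perm_idealP _ _ _ _; apply: (idealMl perm_idealP).
- have -> : 'X_(R k) * 'X_[m'] * (U i * V j - - s * (U j * V i))
    = 'X_[m'] * V j * (U i * V k + U k * V i)
      - V i * ('X_[m'] * (U k * V j - s * (U j * V k))).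
    rewrite /yvar; ring.
  by apply: idealB perm_idealP _ _ _ _; apply: (idealMl perm_idealP).
Qed.

End Permanental.

(** * Moving chips on the support of a monomial *)
Lemma sum_lt_exists (T : finType) (P : pred T) (f g : T -> nat) i :
  (\sum_(k | P k) f k = \sum_(k | P k) g k)%N -> P i -> (g i < f i)%N ->
  exists2 j, P j & (f j < g j)%N.
Proof.
move=> Efg Pi lt_gf.
have [/exists_inP //|/exists_inPn none] := boolP [exists (j | P j), f j < g j]%N.
suff : (\sum_(k | P k) g k < \sum_(k | P k) f k)%N by rewrite Efg ltnn.
rewrite (bigD1 i) // [X in (_ < X)%N](bigD1 i) //= -addSn leq_add //.
by apply: leq_sum => k /andP[/none]; rewrite -leqNgt.
Qed.

Section Pairs.
Variables (n : nat) (A : Type).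

Definition paired (f g : 'I_n -> A) : 'I_(n + n) -> A :=
  fun k => match split k with inl i => f i | inr i => g i end.

Lemma paired_l f g i : paired f g (lshift n i) = f i.
Proof. by rewrite /paired (unsplitK (inl i)). Qed.

Lemma paired_r f g i : paired f g (rshift n i) = g i.
Proof. by rewrite /paired (unsplitK (inr i)). Qed.

Lemma pairedP (f : 'I_(n + n) -> A) k :
  f k = paired (fun i => f (lshift n i)) (fun i => f (rshift n i)) k.
Proof. by rewrite -[k]splitK; case: (split k) => i; rewrite ?paired_l ?paired_r. Qed.

End Pairs.

(** A monomial in the u_i and v_i is pictured as a configuration on the
    vertices: vertex i has as many places as the total degree of u_i and v_i,
    the exponent of u_i counts the chips on them and that of v_i the holes.
    Interchanging u and v between i and j moves one chip from i to j. *)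
Section Moves.
Variables (n : nat).

Local Notation L i := (lshift n i).
Local Notation R i := (rshift n i).
Implicit Types (m : 'X_{1..n + n}).

Definition move_chip (i j : 'I_n) m : 'X_{1..n + n} :=
  (m - (U_(L i) + U_(R j)) + (U_(L j) + U_(R i)))%MM.

Lemma move_chip_split i j m : (0 < m (L i))%N -> (0 < m (R j))%N ->
  {m0 | m = (m0 + (U_(L i) + U_(R j)))%MM
      & move_chip i j m = (m0 + (U_(L j) + U_(R i)))%MM}.
Proof.
move=> mi mj; exists (m - (U_(L i) + U_(R j)))%MM => //; rewrite submK //.
apply/mnm_lepP=> k; rewrite mnmDE !mnm1E.
case: (eqVneq (L i) k) => [<-|_]; first by rewrite lrE.
by case: (eqVneq (R j) k) => [<-|].
Qed.

Section MoveFacts.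
Variables (i j : 'I_n) (m : 'X_{1..n + n}).
Hypotheses (mi : (0 < m (L i))%N) (mj : (0 < m (R j))%N).

Lemma move_chip_l k : (move_chip i j m (L k) + (i == k) = m (L k) + (j == k))%N.
Proof.
by have [m0 -> ->] := move_chip_split mi mj; rewrite !mnmDE !mnm1E !lrE; lia.
Qed.

Lemma move_chip_r k : (move_chip i j m (R k) + (j == k) = m (R k) + (i == k))%N.
Proof.
by have [m0 -> ->] := move_chip_split mi mj; rewrite !mnmDE !mnm1E !lrE; lia.
Qed.

Lemma move_chip_tot k : mtot (move_chip i j m) k = mtot m k.
Proof. by have := move_chip_l k; have := move_chip_r k; rewrite /mtot; lia. Qed.

Lemma move_chip_sum (P : pred 'I_n) : P i = P j ->
  (\sum_(k | P k) move_chip i j m (L k) = \sum_(k | P k) m (L k))%N.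
Proof.
move=> Pij; have one x : (\sum_(k | P k) (x == k) = P x)%N.
  have [Px|nPx] := boolP (P x); last first.
    by rewrite big1 // => k Pk; apply/eqP; rewrite eqb0; apply: contraNneq nPx => ->.
  by rewrite (bigD1 x) //= eqxx big1 // => k /andP[_]; rewrite eq_sym => /negPf ->.
apply: (@addIn (P i)); rewrite {2}Pij -!one -!big_split.
by apply: eq_bigr => k _; apply: move_chip_l.
Qed.

End MoveFacts.
End Moves.

Section Components.
Variables (K : fieldType) (n : nat) (G : rel 'I_n).
Hypotheses (symG : ssrbool.symmetric G) (irrG : irreflexive G).

Local Notation U i := (xvar K (i : 'I_n)).
Local Notation V i := (yvar K (i : 'I_n)).
Local Notation L i := (lshift n i).
Local Notation R i := (rshift n i).
Local Notation P := (perm_ideal (K := K) G).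
Implicit Types (m : 'X_{1..n + n}).

(** Throughout, [a] is the number of places at each vertex and [supp_graph] the
    part of G on the vertices that have a place; moves change neither. *)
Section Support.
Variable a : 'I_n -> nat.

Definition supp_graph : rel 'I_n := fun i j => [&& G i j, 0 < a i & 0 < a j]%N.
Local Notation e := supp_graph.
Local Notation r := (fingraph.root e).

Lemma supp_graph_sym : ssrbool.symmetric e.
Proof. by move=> i j; rewrite /e symG [X in _ && X]andbC. Qed.

Lemma supp_graph_irr : irreflexive e.
Proof. by move=> i; rewrite /e irrG. Qed.

Let csym : connect_sym e := sym_connect_sym supp_graph_sym.

Lemma connect_supp i j : connect e i j -> i != j -> (0 < a i)%N.
Proof.
by case/connectP => [[|k w] /= + ->]; rewrite ?eqxx // => /andP[/and3P[_ ->]].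
Qed.

Lemma supp_comp i k : a i = 0%N -> r k = r i -> k = i.
Proof.
move=> ai rk; have /(fingraph.rootP csym) cik : r i = r k by [].
apply/eqP; apply: contraTT isT => ki.
by have := connect_supp cik; rewrite eq_sym ai => /(_ ki).
Qed.

Lemma path_supp i w : path e i w -> path G i w /\ forall k, k \in w -> (0 < a k)%N.
Proof.
elim: w i => //= k w IH i /andP[/and3P[Gik _ ak] /IH[pw aw]].
by split=> [|x]; [rewrite Gik|rewrite inE => /predU1P[->|/aw]].
Qed.

Lemma move_exchange m i j w : mtot m =1 a -> i != j -> simple_path e i j w ->
  (0 < m (L i))%N -> (0 < m (R j))%N ->
  P ('X_[m] - (-1) ^+ size w *: 'X_[move_chip i j m]).
Proof.
move=> ma ij /and3P[pw uw /eqP lw] mi mj.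
have [Gw aw] := path_supp pw.
have [m0 Em ->] := move_chip_split mi mj.
have -> : 'X_[m] - (-1) ^+ size w *: 'X_[m0 + (U_(L j) + U_(R i))]
   = 'X_[m0] * (U i * V j - (-1) ^+ size w * (U j * V i)).
  rewrite Em !mpolyXD mulrBr; congr (_ - _).
  by rewrite [RHS]mulrCA -[LHS]mul_mpolyC rmorphXn rmorphN1.
rewrite -lw; apply: path_exchange => // k kw; rewrite lw => kj.
have := aw k kw; rewrite -ma Em /mtot !mnmDE !mnm1E !lrE.
have ik : (i == k) = false.
  by apply: contraTF uw => /eqP ->; rewrite /= kw.
by rewrite ik eq_sym (negPf kj); lia.
Qed.

Lemma move_mem m i j : mtot m =1 a -> connect e i j -> i != j ->
  (0 < m (L i))%N -> (0 < m (R j))%N -> P 'X_[move_chip i j m] -> P 'X_[m].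
Proof.
move=> ma cij ij mi mj IH; have [w sw] := simple_pathP cij.
rewrite -['X_[m]](subrK ((-1) ^+ size w *: 'X_[move_chip i j m])).
apply: idealD (perm_idealP _ _) _ _ _ _; first exact: move_exchange.
by rewrite -mul_mpolyC; apply: idealMl (perm_idealP _ _) _ _ _.
Qed.

(** [d] prescribes the number of chips in each component, a component being
    named by its root. *)
Variable d : 'I_n -> nat.

Definition same_class m :=
  mtot m =1 a /\ forall c, (\sum_(k | r k == c) m (L k) = d c)%N.

Definition comp_size c := (\sum_(k | r k == c) a k)%N.

(** Chips can move only in components that hold both chips and holes. *)
Definition mixed c := (0 < d c)%N && (d c < comp_size c)%N.

Lemma class_holes m c : same_class m ->
  (d c + \sum_(k | r k == c) m (R k) = comp_size c)%N.
Proof.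
by move=> [ma md]; rewrite -md -big_split; apply: eq_bigr => k _; apply: ma.
Qed.

Lemma class_move m i j : same_class m -> connect e i j ->
  (0 < m (L i))%N -> (0 < m (R j))%N -> same_class (move_chip i j m).
Proof.
move=> [ma md] /(fingraph.rootP csym) rij mi mj; split=> [k|c].
  by rewrite move_chip_tot.
by rewrite move_chip_sum // rij.
Qed.

Lemma class_chip m i : same_class m -> (0 < m (L i))%N -> (0 < d (r i))%N.
Proof. by move=> [_ <-] mi; rewrite (bigD1 i) //= addn_gt0 mi. Qed.

Lemma class_hole m i : same_class m -> (0 < m (R i))%N -> (d (r i) < comp_size (r i))%N.
Proof.
by move=> /class_holes <- mi; rewrite -ltn_subLR // subnn (bigD1 i) //= addn_gt0 mi.
Qed.

Lemma mixed_chip m c : same_class m -> mixed c -> exists2 i, r i = c & (0 < m (L i))%N.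
Proof.
move=> [_ md] /andP[+ _]; rewrite -md lt0n sum_nat_eq0 negb_forall_in.
by move=> /exists_inP[i /eqP ri mi]; exists i; rewrite // lt0n.
Qed.

Lemma mixed_hole m c : same_class m -> mixed c -> exists2 i, r i = c & (0 < m (R i))%N.
Proof.
move=> cm /andP[_ +]; rewrite -(class_holes c cm) -ltn_subLR // subnn.
rewrite lt0n sum_nat_eq0 negb_forall_in.
by move=> /exists_inP[i /eqP ri mi]; exists i; rewrite // lt0n.
Qed.

Lemma root_connectP i j : r i = r j -> connect e i j.
Proof. by move/(fingraph.rootP csym). Qed.

(** Two simple paths of opposite parity between i and j give
    u_i v_j w = u_j v_i w and u_i v_j w = - u_j v_i w modulo the ideal for the
    same w, so u_i v_j w vanishes since 2 is invertible.  Any configuration of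
    a mixed component can be brought to one with a chip at i and a hole at j. *)
Lemma odd_class_mem m i j p q :
  (2%:R : K) != 0 -> same_class m -> mixed (r i) -> connect e i j -> i != j ->
  simple_path e i j p -> simple_path e i j q ->
  odd (size p) != odd (size q) -> P 'X_[m].
Proof.
move=> nz2 cm mx cij ij sp sq par.
have ai := connect_supp cij ij.
have aj : (0 < a j)%N by apply: (@connect_supp j i); rewrite 1?csym 1?eq_sym.
have idP := perm_idealP K G.
(* With a chip at i and a hole at j, the two paths give both signs. *)
have both m1 : same_class m1 -> (0 < m1 (L i))%N -> (0 < m1 (R j))%N -> P 'X_[m1].
  move=> [m1a _] mi mj.
  have Ep := move_exchange m1a ij sp mi mj.
  have Eq := move_exchange m1a ij sq mi mj.
  have := idealD idP Ep Eq.
  have -> : (-1) ^+ size q = - (-1) ^+ size p :> K.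
    rewrite -signr_odd -[in RHS]signr_odd; move: par.
    by do 2!case: odd; rewrite ?expr0 ?expr1 ?opprK.
  rewrite scaleNr opprK addrACA addNr addr0 => E2.
  rewrite -['X_[m1]]scale1r -(mulVf nz2) -scalerA scaler_nat mulr2n -mul_mpolyC.
  exact: (idealMl idP).
(* Bring a hole to j; the chip at i stays, as i != j. *)
have chip m1 : same_class m1 -> (0 < m1 (L i))%N -> P 'X_[m1].
  move=> cm1 mi; have [|] := posnP (m1 (R j)); last exact: both.
  move=> mj0; have mj : (0 < m1 (L j))%N by have := cm1.1 j; rewrite /mtot mj0; lia.
  have rij : r j = r i by apply/esym/(fingraph.rootP csym).
  have [k rk mk] := mixed_hole cm1 mx.
  have cjk : connect e j k by apply: root_connectP; rewrite rk.
  have jk : j != k by apply: contraTneq mk => <-; rewrite mj0.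
  apply: (move_mem cm1.1 cjk jk mj mk); apply: both; first exact: class_move.
    have := move_chip_l mj mk i; rewrite eq_sym (negPf ij); lia.
  by have := move_chip_r mj mk j; rewrite eqxx [k == j]eq_sym (negPf jk); lia.
(* Bring a chip to i. *)
have [mi0|] := posnP (m (L i)); last exact: chip.
have mi : (0 < m (R i))%N by have := cm.1 i; rewrite /mtot mi0; lia.
have [k rk mk] := mixed_chip cm mx.
have cki := root_connectP rk.
have ki : k != i by apply: contraTneq mk => ->; rewrite mi0.
apply: (move_mem cm.1 cki ki mk mi); apply: chip; first exact: class_move.
by have := move_chip_l mk mi i; rewrite eqxx (negPf ki); lia.
Qed.

(** From here on, mixed components are properly 2-coloured by [eps].  The
    coefficients [alpha] and [beta] describe a point of the vanishing set: u is
    switched off on components without chips, v on components without holes,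
    and the signs of v follow the colouring. *)
Variable eps : 'I_n -> bool.
Hypothesis alt : forall k l, mixed (r k) -> e k l -> eps k != eps l.

Definition alpha i : K := (0 < d (r i))%N%:R.
Definition beta i : K := (-1) ^+ eps i * (d (r i) < comp_size (r i))%N%:R.
Definition weight m : K := mmap1 (paired alpha beta) m.

Lemma weightD m1 m2 : weight (m1 + m2) = weight m1 * weight m2.
Proof. by apply: commr_mmap1_M => i x; apply: mulrC. Qed.

Lemma weight_move m i j : same_class m -> connect e i j -> i != j ->
  (0 < m (L i))%N -> (0 < m (R j))%N ->
  P (weight m *: 'X_[m] - weight (move_chip i j m) *: 'X_[move_chip i j m]).
Proof.
move=> cm cij ij mi mj; have [w sw] := simple_pathP cij.
have rij : r i = r j by apply/(fingraph.rootP csym).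
have d1 := class_chip cm mi; have d2 := class_hole cm mj.
have sgn : (-1) ^+ size w = (-1) ^+ (eps i (+) eps j) :> K.
  case/and3P: sw => pw _ /eqP <-; rewrite -signr_odd.
  rewrite (colour_path (eps := eps) pw) // => k l cik; apply: alt.
  rewrite /mixed; have -> : r k = r i by apply/esym/(fingraph.rootP csym).
  by rewrite d1 rij d2.
have -> : weight (move_chip i j m) = weight m * (-1) ^+ size w.
  have [m0 Em ->] := move_chip_split mi mj; rewrite [in RHS]Em.
  rewrite !weightD /weight !mmap1U !paired_l !paired_r /alpha /beta sgn rij d2.
  rewrite -rij d1 signr_addb.
  by case: (eps i); case: (eps j); rewrite /= ?expr1 ?expr0; ring.
rewrite -scalerA -scalerBr -mul_mpolyC; apply: idealMl (perm_idealP _ _) _ _ _.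
by apply: move_exchange; case: cm.
Qed.

(** The induction is on the number of chips that are not at their place in
    [m']; components have equal numbers of chips in both monomials, so a
    surplus at one vertex is matched by a deficit at a vertex of the same
    component. *)
Lemma weight_class m m' : same_class m -> same_class m' ->
  P (weight m *: 'X_[m] - weight m' *: 'X_[m']).
Proof.
have idP := perm_idealP K G.
move=> cm cm'; have [N] := ubnP (\sum_k (m (L k) - m' (L k)))%N.
elim: N m cm => // N IH m cm leN.
have [/forallP eqm|] := boolP [forall k, m (L k) == m' (L k)].
  suff -> : m = m' by rewrite subrr; apply: ideal0.
  apply/mnmP => k; rewrite pairedP [RHS]pairedP /paired.
  case: (split k) => i; have /eqP := eqm i => //.
  by have := cm.1 i; rewrite -(cm'.1 i) /mtot => + E; rewrite E => /addnI.
rewrite negb_forall => /existsP[k neq_k].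
have [i [j [rij mi mj]]] : exists i j, [/\ r i = r j, (m' (L i) < m (L i))%N
    & (m (L j) < m' (L j))%N].
  have Es : (\sum_(x | r x == r k) m (L x) = \sum_(x | r x == r k) m' (L x))%N.
    by rewrite cm.2 cm'.2.
  case: (ltngtP (m (L k)) (m' (L k))) neq_k => // lt_k _.
    have [i /eqP ri lti] := sum_lt_exists (esym Es) (eqxx _) lt_k.
    by exists i, k.
  have [j /eqP rj ltj] := sum_lt_exists Es (eqxx _) lt_k.
  by exists k, j.
have ij : i != j by apply: contraTneq mi => ->; rewrite -leqNgt ltnW.
have mi0 : (0 < m (L i))%N by lia.
have mj0 : (0 < m (R j))%N.
  by have := cm.1 j; rewrite -(cm'.1 j) /mtot; lia.
have cij := root_connectP rij.
have E := weight_move cm cij ij mi0 mj0.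
rewrite -(subrK (weight (move_chip i j m) *: 'X_[move_chip i j m])
               (weight m *: 'X_[m])) -addrA.
apply: idealD => //; apply: IH; first exact: class_move.
rewrite -ltnS; apply: leq_trans leN; rewrite ltnS.
rewrite (bigD1 i) // [X in (_ < X)%N](bigD1 i) //= -addSn leq_add //.
  by have := move_chip_l mi0 mj0 i; rewrite eqxx eq_sym (negPf ij); lia.
apply: leq_sum => x xi; have := move_chip_l mi0 mj0 x.
rewrite eq_sym (negPf xi).
by case: (eqVneq j x) => [<-|_]; lia.
Qed.

Lemma weight_sqr m : same_class m -> weight m ^+ 2 = 1.
Proof.
move=> cm; rewrite /weight /mmap1 -prodrXl big1 // => k _.
rewrite -exprM mulnC exprM.
rewrite (pairedP m) /paired.
case: (split k) => i.
  have [->|mi] := posnP (m (L i)); first by rewrite expr0.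
  by rewrite /alpha (class_chip cm mi) !expr1n.
have [->|mi] := posnP (m (R i)); first by rewrite expr0.
by rewrite /beta (class_hole cm mi) mulr1 sqrr_sign expr1n.
Qed.

(** An edge in the support joins two vertices of one component: either the
    component is mixed and the signs cancel, or u or v is switched off on it.  A
    vertex outside the support is a component with neither chips nor holes. *)
Lemma weight_param m i j : same_class m -> G i j ->
  alpha i * beta j + alpha j * beta i = 0 /\ (r i != r j -> alpha i * beta j = 0).
Proof.
move=> cm Gij; have zero k : a k = 0%N -> alpha k = 0 /\ beta k = 0.
  move=> ak; have Ek : (fun x => r x == r k) =1 pred1 k.
    by move=> x /=; apply/eqP/eqP => [/(supp_comp ak)|-> //].
  have A0 : comp_size (r k) = 0%N by rewrite /comp_size (eq_bigl _ _ Ek) big_pred1_eq.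
  have d0 : d (r k) = 0%N by have := class_holes (r k) cm; rewrite A0; lia.
  by rewrite /alpha /beta A0 d0 mulr0.
have [/zero[-> ->]|ai] := posnP (a i); first by rewrite mulr0 !mul0r addr0.
have [/zero[-> ->]|aj] := posnP (a j); first by rewrite mulr0 !mul0r addr0.
have eij : e i j by apply/and3P.
have rij : r i = r j by apply/(fingraph.rootP csym)/connect1.
split; last by rewrite rij eqxx.
have := alt _ eij; rewrite /alpha /beta -rij /mixed.
case: (0 < d (r i))%N => /=; last by rewrite !mul0r addr0.
case: (d (r i) < comp_size (r i))%N => /=; last by rewrite !mulr0 addr0.
move=> /(_ isT); rewrite !mul1r !mulr1.
by case: (eps i); case: (eps j); rewrite // expr1 expr0 ?subrr ?addNr.
Qed.

End Support.
End Components.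

(** * Membership in the permanental ideal is tested by parametrizations *)
Lemma mpolyX_comp (K : comNzRingType) (N M : nat) (c : 'I_N -> K)
    (w : 'I_N -> 'X_{1..M}) m :
  mmap (@mpolyC M K) (fun k => c k *: 'X_[w k]) 'X_[m]
  = mmap1 c m *: 'X_[(\sum_k w k *+ m k)%MM].
Proof.
rewrite mmapX /mmap1 -mprodXnE -scaler_prod; apply: eq_bigr => k _.
by rewrite exprZn.
Qed.

Section Parametrizations.
Variables (K : fieldType) (n : nat) (G : rel 'I_n).
Hypotheses (symG : ssrbool.symmetric G) (irrG : irreflexive G).

Local Notation L i := (lshift n i).
Local Notation R i := (rshift n i).
Local Notation P := (perm_ideal (K := K) G).
Implicit Types (m : 'X_{1..n + n}) (r : 'I_n -> 'I_n) (al be : 'I_n -> K).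

(** The conditions say that u_i = al_i t_i p_(r i), v_i = be_i t_i solves all
    the equations u_i v_j + u_j v_i = 0 identically in the parameters t and p. *)
Definition param_data r al be : Prop := forall i j, G i j ->
  al i * be j + al j * be i = 0 /\ (r i != r j -> al i * be j = 0).

Definition param_mnm r : 'I_(n + n) -> 'X_{1..n + n} :=
  paired (fun i => U_(L i) + U_(R (r i)))%MM (fun i => U_(L i))%MM.

(** The parameters t_i and p_c occupy the places of the variables u_i and v_c
    of the ring. *)
Definition param r al be : {mpoly K[n + n]} -> {mpoly K[n + n]} :=
  mmap (@mpolyC _ K) (fun k => paired al be k *: 'X_[param_mnm r k]).

HB.instance Definition _ r al be := GRing.RMorphism.on (param r al be).

(** The parametrization sends the monomial [m] to a multiple of [class_mnm r m],
    which records the degree at each vertex and the number of chips in each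
    fibre of [r]; when [r] gives the roots of the components, this is exactly
    the class of [m]. *)
Definition class_mnm r m := (\sum_k param_mnm r k *+ m k)%MM.

Lemma class_mnmE r m :
  (forall i, class_mnm r m (L i) = mtot m i)
  /\ (forall c, class_mnm r m (R c) = \sum_(k | r k == c) m (L k))%N.
Proof.
rewrite /class_mnm; split=> x; rewrite mnm_sumE big_split_ord /=.
  rewrite (bigD1 x) //= [X in (_ + X)%N](bigD1 x) //=.
  rewrite !mulmnE /param_mnm paired_l paired_r mnmDE !mnm1E !lrE eqxx /= addn0 !mul1n.
  rewrite !big1 => [|k kx|k kx]; first by rewrite !addn0.
    by rewrite mulmnE paired_r mnm1E lrE (negPf kx).
  by rewrite mulmnE paired_l mnmDE !mnm1E !lrE (negPf kx).
rewrite [X in (_ + X)%N]big1 => [|k _]; last first.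
  by rewrite mulmnE /param_mnm paired_r mnm1E lrE.
rewrite addn0 [RHS]big_mkcond; apply: eq_bigr => k _.
rewrite mulmnE /param_mnm paired_l mnmDE !mnm1E !lrE.
by case: ifP; rewrite ?mul1n ?mul0n.
Qed.

Lemma paramX r al be m :
  param r al be 'X_[m] = mmap1 (paired al be) m *: 'X_[class_mnm r m].
Proof. exact: mpolyX_comp. Qed.

Lemma param_kills r al be g : param_data r al be -> P g -> param r al be g = 0.
Proof.
move=> data; apply: (ideal_span_morph (f := param r al be) (@is_ideal_zero _)).
case=> i j /= Gij; have [E0 Er] := data _ _ Gij.
have [_ Er'] := data j i (etrans (symG _ _) Gij).
rewrite rmorphD !rmorphM /xvar /yvar /= !paramX !mmap1U !paired_l !paired_r.
have clU k : class_mnm r U_(k) = param_mnm r k.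
  rewrite /class_mnm (bigD1 k) //= big1 => [|l lk].
    by rewrite mnm1E eqxx addm0.
  by rewrite mnm1E eq_sym (negPf lk).
rewrite !clU /param_mnm !paired_l !paired_r.
rewrite -!scalerAl -!scalerAr !scalerA.
have [rij|rij] := eqVneq (r i) (r j).
  rewrite rij -!mpolyXD.
  have -> : (U_(L j) + U_(R (r j)) + U_(L i) = U_(L i) + U_(R (r j)) + U_(L j))%MM.
    by apply/mnmP => k; rewrite !mnmDE; lia.
  by rewrite -scalerDl E0 scale0r.
by rewrite Er // Er' 1?eq_sym // !scale0r addr0.
Qed.

Hypothesis nz2 : (2%:R : K) != 0.

(** Modulo the permanental ideal, the class of a monomial [m0] is either zero,
    or one-dimensional and detected by a parametrization.  The alternative is
    whether the parity colouring is proper on the mixed components. *)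
Lemma class_dichotomy m0 (a := mtot m0) (e := supp_graph G a) (r := fingraph.root e)
    (S := fun m => class_mnm r m == class_mnm r m0) :
  (forall m, S m -> P 'X_[m]) \/
  exists al be, [/\ param_data r al be,
    forall m, S m -> mmap1 (paired al be) m ^+ 2 = 1
  & forall m, S m -> P (mmap1 (paired al be) m *: 'X_[m]
                        - mmap1 (paired al be) m0 *: 'X_[m0])].
Proof.
pose d c := (\sum_(k | r k == c) m0 (L k))%N.
have SP m : S m -> same_class G a d m.
  move/eqP/mnmP => E; split=> [i|c].
    by have := E (L i); rewrite !(class_mnmE _ _).1.
  by have := E (R c); rewrite !(class_mnmE _ _).2.
have symE : ssrbool.symmetric e by apply: supp_graph_sym.
have irrE : irreflexive e by apply: supp_graph_irr.
pose eps := colour symE.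
have [/'forall_'forall_implyP alt|] :=
  boolP [forall k, forall l, mixed G a d (r k) && e k l ==> (eps k != eps l)].
  right; exists (alpha K G a d), (beta K G a d eps).
  have {}alt k l : mixed G a d (r k) -> e k l -> eps k != eps l.
    by move=> mk ekl; apply: alt; rewrite mk.
  have S0 : same_class G a d m0 by apply: SP; apply: eqxx.
  split=> [i j Gij|m /SP|m /SP Sm].
  - exact: (weight_param K symG alt S0 Gij).
  - exact: weight_sqr.
  - exact: weight_class.
rewrite negb_forall => /existsP[k]; rewrite negb_forall => /existsP[l].
rewrite negb_imply negbK => /andP[/andP[mk ekl] /eqP ckl].
have [i [j [p [q [cik ij sp sq par]]]]] := odd_pair irrE ekl ckl.
left=> m /SP Sm; apply: (odd_class_mem symG nz2 Sm _ _ ij sp sq par).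
  suff -> : fingraph.root e i = r k by [].
  exact/(fingraph.rootP (sym_connect_sym symE)).
by case/and3P: sp => pp _ /eqP <-; apply/connectP; exists p.
Qed.

(** Take a monomial of g and the part h of g in its class.  If the class is not
    zero modulo the ideal, h is congruent to a multiple of one monomial, and the
    factor is, up to sign, a coefficient of the image of g under the
    parametrization of the class, hence 0.  So h lies in the ideal, and g - h
    has fewer terms. *)
Lemma mem_of_params g :
  (forall r al be, param_data r al be -> param r al be g = 0) -> P g.
Proof.
have idP := perm_idealP K G.
have [N] := ubnP (size (msupp g)); elim: N g => // N IH g leN kill.
have [->|nz_g] := eqVneq g 0; first exact: ideal0.
pose m0 := mlead g; have m0g : m0 \in msupp g := mlead_supp nz_g.
pose r := fingraph.root (supp_graph G (mtot m0)).
pose S m := class_mnm r m == class_mnm r m0.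
pose h := \sum_(m <- msupp g | S m) g@_m *: 'X_[m].
have Ph : P h.
  case: (class_dichotomy m0) => [PS|[al [be [data wt1 wtP]]]].
    apply: ideal_sum => // m Sm; rewrite -mul_mpolyC.
    by apply: (idealMl idP); apply: PS.
  pose wt m := mmap1 (paired al be) m.
  have coef0 : \sum_(m <- msupp g | S m) g@_m * wt m = 0.
    have -> : \sum_(m <- msupp g | S m) g@_m * wt m
        = (param r al be g)@_(class_mnm r m0); last by rewrite kill ?mcoeff0.
    rewrite /param /mmap raddf_sum big_mkcond; apply: eq_bigr => m _.
    rewrite -(mmapX _ (@mpolyC _ K)) -/(param r al be _) paramX mul_mpolyC /=.
    rewrite !mcoeffZ mcoeffX.
    by rewrite /S; case: eqP; rewrite ?mulr1 ?mulr0.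
  have -> : h = \sum_(m <- msupp g | S m)
      (g@_m * wt m) *: (wt m *: 'X_[m] - wt m0 *: 'X_[m0]).
    rewrite -[LHS]subr0 -[X in _ - X](scale0r (wt m0 *: 'X_[m0])) -coef0.
    rewrite scaler_suml -sumrB; apply: eq_bigr => m Sm.
    by rewrite scalerBr !scalerA -[_ * wt m * wt m]mulrA -expr2 wt1 // mulr1.
  apply: ideal_sum => // m Sm; rewrite -mul_mpolyC.
  by apply: (idealMl idP); apply: wtP.
rewrite -(subrK h g); apply: (idealD idP) => //.
have Egh : g - h = \sum_(m <- msupp g | ~~ S m) g@_m *: 'X_[m].
  by rewrite {1}(mpolyE g) (bigID S) addrAC subrr add0r.
have supp_gh m : m \in msupp (g - h) -> (m \in msupp g) && ~~ S m.
  rewrite mcoeff_msupp Egh raddf_sum /=; apply: contraR => out.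
  rewrite big1_seq // => m' /andP[Sm' gm']; rewrite mcoeffZ mcoeffX.
  by case: eqP out => [<-|_ _]; rewrite ?mulr0 // gm' Sm'.
apply: IH => [|r' al be data]; last first.
  by rewrite rmorphB /= (kill _ _ _ data) (param_kills data Ph) subrr.
rewrite -ltnS; apply: leq_trans leN; rewrite ltnS (perm_size (perm_to_rem m0g)) /= ltnS.
apply: uniq_leq_size; first exact: msupp_uniq.
move=> m /supp_gh/andP[mg Sm]; rewrite mem_rem_uniq ?msupp_uniq // !inE mg andbT.
by apply: contraNneq Sm => ->; rewrite /S.
Qed.

End Parametrizations.

(** * Change of coordinates over a field with a square root of -1 *)
Lemma mpoly_morph_ext (K S : comNzRingType) N (f g : {rmorphism {mpoly K[N]} -> S}) :
  (forall c, f c%:MP = g c%:MP) -> (forall i, f 'X_i = g 'X_i) -> f =1 g.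
Proof.
move=> fgC fgX p; rewrite (mpolyE p) !rmorph_sum; apply: eq_bigr => m _.
rewrite -mul_mpolyC !rmorphM fgC mpolyXE_id !rmorph_prod; congr (_ * _).
by apply: eq_bigr => i _; rewrite !rmorphXn fgX.
Qed.

(** With u = x + iota y and v = x - iota y one has
    u_i v_j + u_j v_i = 2 (x_i x_j + y_i y_j). *)
Section Coordinates.
Variables (K : fieldType) (n : nat) (G : rel 'I_n) (iota : K).
Hypotheses (symG : ssrbool.symmetric G) (irrG : irreflexive G).
Hypotheses (nz2 : (2%:R : K) != 0) (sqr_iota : iota ^+ 2 = -1).

Local Notation X i := (xvar K (i : 'I_n)).
Local Notation Y i := (yvar K (i : 'I_n)).

(** The second factor is 1 / (2 iota), as iota^-1 = - iota. *)
Definition to_uv : {mpoly K[n + n]} -> {mpoly K[n + n]} :=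
  mmap (@mpolyC _ K) (paired (fun i => (2%:R^-1)%:MP * (X i + Y i))
                             (fun i => (- iota * 2%:R^-1)%:MP * (X i - Y i))).

Definition of_uv : {mpoly K[n + n]} -> {mpoly K[n + n]} :=
  mmap (@mpolyC _ K) (paired (fun i => X i + iota%:MP * Y i)
                             (fun i => X i - iota%:MP * Y i)).

HB.instance Definition _ := GRing.RMorphism.on to_uv.
HB.instance Definition _ := GRing.RMorphism.on of_uv.

Lemma iotaMP : iota%:MP ^+ 2 = -1 :> {mpoly K[n + n]}.
Proof. by rewrite -rmorphXn /= sqr_iota rmorphN1. Qed.

Lemma halfMP : (2%:R^-1)%:MP * 2%:R = 1 :> {mpoly K[n + n]}.
Proof. by rewrite -mpolyC_nat -mpolyCM mulVf. Qed.

Lemma to_uvX i : to_uv (X i) = (2%:R^-1)%:MP * (X i + Y i).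
Proof. by rewrite /to_uv mmapX mmap1U paired_l. Qed.
Lemma to_uvY i : to_uv (Y i) = (- iota * 2%:R^-1)%:MP * (X i - Y i).
Proof. by rewrite /to_uv mmapX mmap1U paired_r. Qed.
Lemma of_uvX i : of_uv (X i) = X i + iota%:MP * Y i.
Proof. by rewrite /of_uv mmapX mmap1U paired_l. Qed.
Lemma of_uvY i : of_uv (Y i) = X i - iota%:MP * Y i.
Proof. by rewrite /of_uv mmapX mmap1U paired_r. Qed.
Lemma of_uvC c : of_uv c%:MP = c%:MP. Proof. exact: mmapC. Qed.
Lemma to_uvC c : to_uv c%:MP = c%:MP. Proof. exact: mmapC. Qed.

Lemma to_uvK : cancel to_uv of_uv.
Proof.
apply: (mpoly_morph_ext (f := of_uv \o to_uv) (g := idfun)) => [c|k] /=.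
  by rewrite to_uvC of_uvC.
rewrite -[k]splitK; case: (split k) => i /=.
  rewrite -/(xvar K i) to_uvX rmorphM rmorphD /= of_uvC of_uvX of_uvY.
  rewrite -[RHS]mul1r -halfMP; ring.
rewrite -/(yvar K i) to_uvY rmorphM rmorphB /= of_uvC of_uvX of_uvY.
rewrite rmorphM rmorphN /=.
have -> : - iota%:MP * (2%:R^-1)%:MP * (X i + iota%:MP * Y i - (X i - iota%:MP * Y i))
  = - (iota%:MP ^+ 2) * ((2%:R^-1)%:MP * 2%:R) * Y i by ring.
by rewrite iotaMP halfMP opprK !mul1r.
Qed.

Lemma to_uv_L p : L_ideal G p -> perm_ideal G (to_uv p).
Proof.
have idP := perm_idealP K G.
apply: (ideal_span_morph (f := to_uv)) => // -[i j] /= Gij.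
rewrite rmorphD !rmorphM /= !to_uvX !to_uvY mpolyCM mpolyCN.
set s := iota%:MP; set t := (2%:R^-1)%:MP.
have -> : t * (X i + Y i) * (t * (X j + Y j))
    + (- s * t) * (X i - Y i) * ((- s * t) * (X j - Y j))
  = t ^+ 2 * ((X i + Y i) * (X j + Y j) + s ^+ 2 * ((X i - Y i) * (X j - Y j))) by ring.
rewrite iotaMP.
have -> : t ^+ 2 * ((X i + Y i) * (X j + Y j) + -1 * ((X i - Y i) * (X j - Y j)))
  = t ^+ 2 * 2%:R * (X i * Y j + X j * Y i) by ring.
by apply: (idealMl idP); apply: perm_edge.
Qed.

Lemma of_uv_perm p : perm_ideal G p -> L_ideal G (of_uv p).
Proof.
have idL : is_ideal (@L_ideal K n G) by apply: ideal_span_is_ideal.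
apply: (ideal_span_morph (f := of_uv)) => // -[i j] /= Gij.
rewrite rmorphD !rmorphM /= !of_uvX !of_uvY.
have -> : (X i + iota%:MP * Y i) * (X j - iota%:MP * Y j)
   + (X j + iota%:MP * Y j) * (X i - iota%:MP * Y i)
  = 2%:R * (X i * X j + (- iota%:MP ^+ 2) * (Y i * Y j)) by ring.
rewrite iotaMP opprK mul1r.
by apply: (idealMl idL); apply: (@ideal_span_gen _ _ _ _ (i, j)).
Qed.

Lemma L_param_kills r al be p : param_data G r al be -> L_ideal G p ->
  param r al be (to_uv p) = 0.
Proof. by move=> data Lp; apply: (param_kills symG data); apply: to_uv_L. Qed.

Lemma L_of_params p :
  (forall r al be, param_data G r al be -> param r al be (to_uv p) = 0) ->
  L_ideal G p.
Proof.
by move=> kill; rewrite -[p]to_uvK; apply/of_uv_perm/mem_of_params.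
Qed.

(** The parametrizations take values in a polynomial ring over a field, which
    is reduced. *)
Lemma L_radical_iota (p : {mpoly K[n + n]}) m : L_ideal G (p ^+ m) -> L_ideal G p.
Proof.
move=> Lpm; apply: L_of_params => r al be data; apply/eqP.
have := L_param_kills data Lpm; rewrite !rmorphXn /= => /eqP.
by rewrite expf_eq0 => /andP[].
Qed.

End Coordinates.

(** * Vanishing at the points over an algebraically closed field *)
Section ClosedField.
Variables (K : fieldType).
Hypothesis closedK : GRing.closed_field_axiom K.

Lemma closed_poly_eq0 (p : {poly K}) : (forall x, p.[x] = 0) -> p = 0.
Proof.
move=> p0; apply/eqP; apply/negPn/negP => /(PreClosedField.closed_nonrootP closedK)[x].
by rewrite /root p0 eqxx.
Qed.

(** The exponents of the variables are fixed one variable after the other: once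
    those of the first k variables agree with [m0], the remaining sum is a
    one-variable polynomial in the next variable, which vanishes everywhere. *)
Lemma closed_mpoly_eq0 N (f : {mpoly K[N]}) : (forall v, f.@[v] = 0) -> f = 0.
Proof.
move=> f0; apply/mpolyP => m0; rewrite mcoeff0.
have partial k : (k <= N)%N -> forall v : 'I_N -> K,
  \sum_(m <- msupp f | [forall i : 'I_N, (i < k)%N ==> (m i == m0 i)])
     f@_m * \prod_(i < N | (k <= i)%N) v i ^+ m i = 0.
  elim: k => [|k IH] lekN v.
    rewrite -[RHS](f0 v) mevalE big_mkcond; apply: eq_bigr => m _.
    by case: ifP => // /negbT/forallPn[i].
  pose x := Ordinal lekN.
  pose q := \sum_(m <- msupp f | [forall i : 'I_N, (i < k)%N ==> (m i == m0 i)])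
     (f@_m * \prod_(i < N | (k < i)%N) v i ^+ m i) *: 'X^(m x) : {poly K}.
  have q0 : q = 0.
    apply: closed_poly_eq0 => y.
    rewrite -[RHS](IH (ltnW lekN) (fun i => if i == x then y else v i)) horner_sum.
    apply: eq_bigr => m _; rewrite hornerZ hornerXn -mulrA; congr (_ * _).
    rewrite [RHS](bigD1 x) //= eqxx mulrC; congr (_ * _).
    apply: eq_big => [i|i ki]; first by rewrite ltn_neqAle -val_eqE eq_sym andbC.
    by case: eqP ki => // ->; rewrite ltnn.
  have /(congr1 (fun p : {poly K} => p`_(m0 x))) := q0.
  rewrite coef0 coef_sum => E0; rewrite -[RHS]E0 big_mkcond [RHS]big_mkcond.
  apply: eq_bigr => m _ /=; rewrite coefZ coefXn.
  have -> : [forall i : 'I_N, (i < k.+1)%N ==> (m i == m0 i)]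
     = [forall i : 'I_N, (i < k)%N ==> (m i == m0 i)] && (m x == m0 x).
    apply/forallP/andP => [all|[/forallP all /eqP mx] i].
      split; last by have := all x; rewrite ltnSn.
      by apply/forallP => i; apply/implyP => ik; have := all i; rewrite ltnS ltnW.
    apply/implyP; rewrite ltnS leq_eqVlt => /orP[/eqP ik|ik].
      by have -> : i = x by [apply: val_inj]; rewrite mx.
    by have := all i; rewrite ik.
  case: ifP => /= [/andP[-> /eqP ->]|]; first by rewrite eqxx mulr1.
  by case: ifP => //= _; rewrite eq_sym => ->; rewrite mulr0.
have := partial N (leqnn N) (fun=> 0).
have [m0f|/memN_msupp_eq0 //] := boolP (m0 \in msupp f).
rewrite big_mkcond (bigD1_seq m0) ?msupp_uniq //= ifT; last first.
  by apply/forallP => i; rewrite eqxx implybT.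
rewrite big1 ?mulr1 => [|i]; last by rewrite leqNgt ltn_ord.
rewrite big1 ?addr0 // => m /eqP neq_m; case: ifP => // /forallP all.
by case: neq_m; apply/mnmP => i; have := all i; rewrite ltn_ord => /eqP.
Qed.

Lemma closed_sqr_root : exists iota : K, iota ^+ 2 = -1.
Proof.
have [x Ex] := @closedK 2 (fun i => if i == 0%N then -1 else 0) isT.
by exists x; rewrite Ex !big_ord_recl big_ord0 /= mul0r !addr0 expr0 mulr1.
Qed.

(** Every parametrization, evaluated at values of the parameters, is a point of
    the vanishing set; so p vanishes on all values of all parametrizations. *)
Lemma L_nullstellensatz n (G : rel 'I_n) p :
  ssrbool.symmetric G -> irreflexive G -> (2%:R : K) != 0 ->
  (forall A, vanishing_set (@L_ideal K n G) A -> eval_mx p A = 0) ->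
  L_ideal G p.
Proof.
move=> symG irrG nz2 p0; have [iota sqr_iota] := closed_sqr_root.
apply: (L_of_params symG irrG nz2 sqr_iota) => r al be data.
apply: closed_mpoly_eq0 => v.
pose w k := (param r al be (to_uv iota 'X_k)).@[v].
pose A : 'M[K]_(n, 2) :=
  \matrix_(i, j) if j == 0 then w (lshift n i) else w (rshift n i).
have evalA q : eval_mx q A = (param r al be (to_uv iota q)).@[v].
  rewrite /eval_mx; transitivity (q.@[w]).
    apply: meval_eq => k; rewrite [RHS]pairedP /paired.
    by case: (split k) => i; rewrite mxE.
  pose eval_param := meval v \o (param r al be \o to_uv iota).
  apply: (mpoly_morph_ext (f := meval w) (g := eval_param)) => [c|k] /=.
    by rewrite to_uvC [param _ _ _ _]mmapC !mevalC.
  by rewrite mevalXU.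
rewrite -evalA; apply: p0 => q Lq; rewrite evalA.
by rewrite (L_param_kills symG sqr_iota data Lq) meval0.
Qed.

End ClosedField.

(** * Descent from a field extension *)
(** A linear form [rho] on F with rho(1) = 1, applied to coefficients, is
    linear over the polynomials with coefficients in K; it turns an expression
    of p over F in terms of generators over K into one over K. *)
Section Descent.
Variables (K : fieldType) (F : fieldExtType K) (N : nat).
Variables (rho : {scalar F}) (rho1 : rho 1 = 1).

Local Notation ext := (map_mpoly (in_alg F)).

Lemma map_mpolyZX (f : {additive F -> K}) z (m : 'X_{1..N}) :
  map_mpoly f (z *: 'X_[m]) = f z *: 'X_[m].
Proof.
apply/mpolyP => k; rewrite mcoeff_map_mpoly !mcoeffZ !mcoeffX.
by case: eqP => _; rewrite ?mulr1 ?mulr0 ?raddf0.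
Qed.

Lemma descend_mul (c : {mpoly F[N]}) (q : {mpoly K[N]}) :
  map_mpoly rho (c * ext q) = map_mpoly rho c * q.
Proof.
rewrite (mpolyE c) (mpolyE q) rmorph_sum !raddf_sum mulr_suml raddf_sum mulr_suml.
apply: eq_bigr => m _; rewrite !mulr_sumr raddf_sum; apply: eq_bigr => k _ /=.
rewrite map_mpolyZX map_mpolyZ map_mpolyX -!scalerAl -!scalerAr !scalerA -!mpolyXD.
rewrite map_mpolyZX; congr (_ *: _).
by rewrite /= mulr_algr scalarZ mulrC.
Qed.

Lemma ideal_span_descent (T : finType) (P : pred T) (g : T -> {mpoly K[N]}) p :
  ideal_span P (fun t => ext (g t)) (ext p) -> ideal_span P g p.
Proof.
case=> c Ep; exists (fun t => map_mpoly rho (c t)).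
have := congr1 (map_mpoly rho) Ep.
rewrite -[ext p]mul1r descend_mul raddf_sum.
rewrite (eq_bigr _ (fun t _ => descend_mul (c t) (g t))) => <-.
rewrite -[1]/(1%:MP) map_mpolyC /= rho1 mul1r //.
Qed.

End Descent.

(** * Radicality *)
Lemma adjoin_sqr_root (K : fieldType) :
  (forall x : K, x ^+ 2 != -1) ->
  exists (F : fieldExtType K) (iota : F), iota ^+ 2 = -1.
Proof.
move=> no_root; pose q : {poly K} := 'X^2 + 1%:P.
have szq : size q = 3 by rewrite size_polyDl size_polyXn // size_polyC oner_eq0.
have irrq : irreducible_poly q.
  apply: cubic_irreducible => [|x]; first by rewrite szq.
  by rewrite /root !hornerE -[1]opprK subr_eq0 no_root.
have [F _ [z rz _]] := irredp_FAdjoin irrq.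
exists F, z; move: rz; rewrite /root rmorphD /= map_polyXn map_polyC /=.
by rewrite !hornerE scale1r addr_eq0 => /eqP.
Qed.

Lemma L_radical (K : fieldType) n (G : rel 'I_n) p m :
  ssrbool.symmetric G -> irreflexive G -> (2%:R : K) != 0 ->
  L_ideal G (p ^+ m : {mpoly K[n + n]}) -> L_ideal G p.
Proof.
move=> symG irrG nz2 Lpm.
have [[iota sqr_iota]|no_root] := classic (exists x : K, x ^+ 2 = -1).
  exact: L_radical_iota sqr_iota _ _ Lpm.
have [x|F [iota sqr_iota]] := @adjoin_sqr_root K.
  by apply/eqP => Ex; apply: no_root; exists x.
have nz2F : (2%:R : F) != 0 by rewrite -(rmorph_nat (in_alg F)) fmorph_eq0.
have coord1 : coord [tuple (1 : F)] ord0 1 = 1.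
  have := @coord_free _ _ _ [tuple (1 : F)] ord0 ord0; rewrite eqxx => -> //.
  by rewrite /= seq1_free oner_eq0.
apply: (ideal_span_descent coord1).
have Egen (e : 'I_n * 'I_n) :
    xvar F e.1 * xvar F e.2 + yvar F e.1 * yvar F e.2
    = map_mpoly (in_alg F) (xvar K e.1 * xvar K e.2 + yvar K e.1 * yvar K e.2).
  by rewrite rmorphD !rmorphM /= !map_mpolyX.
have LF q : L_ideal G q -> L_ideal G (map_mpoly (in_alg F) q).
  apply: (ideal_span_morph (f := map_mpoly (in_alg F))) => [|e Ge].
    exact: ideal_span_is_ideal.
  by rewrite /= -Egen; apply: (@ideal_span_gen _ _ _ _ e).
have := LF _ Lpm; rewrite rmorphXn => /(L_radical_iota symG irrG nz2F sqr_iota).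
by case=> c Ec; exists c; rewrite Ec; apply: eq_bigr => e _; rewrite Egen.
Qed.

Theorem theorem1p1 (K : fieldType) (n : nat) (G : rel 'I_n)
    (hG : is_simple_graph G) (hK : 2%N \notin [pchar K]) :
  is_radical_ideal (@L_ideal K n G) /\
  (GRing.closed_field_axiom K ->
   forall p : {mpoly K[n + n]},
     (forall A : 'M[K]_(n, 2), OR2 G A -> eval_mx p A = 0) ->
     L_ideal (compl_graph G) p).
Proof.
have [symG irrG] := hG.
have nz2 : (2%:R : K) != 0 by apply: contraNneq hK => /eqP; rewrite inE.
split.
  split=> [|p]; first exact: ideal_span_is_ideal.
  split=> [[m]|Lp]; first exact: L_radical.
  by exists 1%N; rewrite expr1.
move=> closedK p p0; apply: L_nullstellensatz => //.
  by move=> i j; rewrite /compl_graph eq_sym symG.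
by move=> i; rewrite /compl_graph eqxx.
Qed.
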